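(* Let $\mathcal{H}$ be a complex Hilbert space. The following assertions hold: (1) Let $T\in\mathcal{L}(\mathcal{H})$ be a split operator such that $T^*\in\mathcal{P}\cdot\mathcal{L}^h$. Then the $Q_T$-proper splitting of $T$ converges if and only if $\|P_{T^*}(I-T)\|<1$. (2) Let $T\in\mathcal{L}(\mathcal{H})$ have closed range and be such that $T^*\in\mathcal{P}\cdot\mathcal{L}^+$. Then the $Q_T$-proper splitting of $T$ converges if and only if $\|P_{T^*}(I-T)\|<1$. (3) Let $T\in\mathcal{L}(\mathcal{H})$ have closed range and be such that $T\in\mathcal{P}\cdot\mathcal{P}$. Then the $Q_T$-proper splitting of $T$ converges.
   Context: $\mathcal{P}$, $\mathcal{L}^+$, $\mathcal{L}^h$ denote the sets of orthogonal projections, positive (semidefinite) operators and Hermitian operators in $\mathcal{L}(\mathcal{H})$; $\mathcal{P}\cdot\mathcal{P}$, $\mathcal{P}\cdot\mathcal{L}^+$, $\mathcal{P}\cdot\mathcal{L}^h$ denote the sets of products $PX$ with $P\in\mathcal{P}$ and $X$ in $\mathcal{P}$, $\mathcal{L}^+$, $\mathcal{L}^h$, respectively. $T$ is a split operator if it has closed range and $\mathcal{R}(T)\dotplus\mathcal{N}(T)=\mathcal{H}$ (direct sum). It is known that a closed range operator in $\mathcal{P}\cdot\mathcal{P}$ or $\mathcal{P}\cdot\mathcal{L}^+$ is a split operator, and that $T$ is split if and only if $T^*$ is; so in (2) and (3) $T$ is a split operator. $Q_T$ is the (oblique) projection onto $\mathcal{R}(T)$ along $\mathcal{N}(T)$,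 and $P_{T^*}$ is the orthogonal projection onto $\mathcal{R}(T^* )$. The $Q_T$-proper splitting of a split operator $T$ is $T=Q_T-V$, i.e. $V=Q_T-T$; it converges if $\rho(Q_T^\dagger V)<1$, where $\rho$ is the spectral radius and $Q_T^\dagger$ the Moore-Penrose inverse of $Q_T$. *)

(* Defs.v *)
(* A complex Hilbert space is a complete normed module H over
   R[i], R : realType, together with an inner product ip (linear in its first
   argument, conjugate-linear in its second) inducing the norm of H. *)
From HB Require Import structures.
From mathcomp Require Export all_boot all_order all_algebra sesquilinear complex.
From mathcomp Require Export all_classical all_reals all_analysis.

Set Implicit Arguments.
Unset Strict Implicit.
Unset Printing Implicit Defensive.

Export Order.TTheory GRing.Theory Num.Theory.
Export numFieldNormedType.Exports.

Global Open Scope classical_set_scope.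
Global Open Scope ring_scope.

Section BoundedOperators.
Context (R : realType) (H : completeNormedModType R[i]).
Implicit Types (A T U V : H -> H) (M N : set H).

Definition bounded_op : set (H -> H) :=
  [set A | linear A /\ continuous A].

Definition kernel A : set H := A @^-1` [set 0].

Definition closed_range A := closed (range A).

Definition direct_sum M N :=
  (forall x, exists2 y, M y & N (x - y)) /\ M `&` N = [set 0].

Definition split_op T :=
  closed_range T /\ direct_sum (range T) (kernel T).

(* Meaningful when M and N are complementary subspaces: the value at x is then
   the unique y in M with x - y in N. *)
Definition proj_along M N (x : H) : H :=
  xget 0 [set y | M y /\ N (x - y)].

Definition oblique_proj T : H -> H := proj_along (range T) (kernel T).

(* `|x| lives in R[i] (with zero imaginary part), hence complex.Re; the supremum
   is taken in \bar R, so that no boundedness side condition is hidden. *)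
Definition opnorm A : \bar R :=
  ereal_sup [set (complex.Re `|A x|)%:E | x in [set x : H | `|x| <= 1]].

Definition invertible_op A :=
  exists B, [/\ bounded_op B, A \o B = id & B \o A = id].

Definition spectrum A : set R[i] :=
  [set l | ~ invertible_op (fun x => l *: x - A x)].

(* On the trivial space the spectrum is empty and the radius is -oo. *)
Definition spectral_radius A : \bar R :=
  ereal_sup [set (complex.Re `|l|)%:E | l in spectrum A].

End BoundedOperators.

Section HilbertSpaceOperators.
Context (R : realType) (H : completeNormedModType R[i]).
Variable ip : {dot H for (@Num.conj R[i])}.
Implicit Types (A T U V X : H -> H) (M : set H).

Definition inner_product_norm := forall x : H, `|x| ^+ 2 = ip x x.

(* For bounded A, the unique z with <A x, y> = <x, z> for all x (Riesz). *)
Definition adjoint A (y : H) : H :=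
  xget 0 [set z | forall x, ip (A x) y = ip x z].

Definition hermitian_op : set (H -> H) :=
  [set A | bounded_op A /\ adjoint A = A].

Definition positive_op : set (H -> H) :=
  [set A | bounded_op A /\ forall x, 0 <= ip (A x) x].

Definition orthogonal_projection : set (H -> H) :=
  [set P | [/\ bounded_op P, P \o P = P & adjoint P = P]].

Definition op_products (S1 S2 : set (H -> H)) : set (H -> H) :=
  [set P \o A | P in S1 & A in S2].

Definition orth_compl M : set H :=
  [set x | forall y, M y -> ip x y = 0].

Definition orth_proj_range A : H -> H :=
  proj_along (range A) (orth_compl (range A)).

Definition is_moore_penrose A X :=
  bounded_op X /\
  [/\ A \o X \o A = A, X \o A \o X = X,
      adjoint (A \o X) = A \o X & adjoint (X \o A) = X \o A].

(* Exists (and is unique) for bounded A with closed range. *)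
Definition moore_penrose A : H -> H :=
  xget (fun=> 0) [set X | is_moore_penrose A X].

(* The splitting is U - V, with iteration operator U^\dagger V. *)
Definition splitting_converges U V :=
  (spectral_radius (moore_penrose U \o V) < 1)%E.

Definition QT_splitting_converges T :=
  splitting_converges (oblique_proj T) (oblique_proj T \- T).

End HilbertSpaceOperators.

(* Main.v *)
(** Let p be the orthogonal projection onto R(T^* ).  A Moore-Penrose inverse
    of Q_T coincides with p on R(T), so the iteration operator of the splitting
    is W = p (I - T).  If T^* = P X with X self-adjoint, then T = X p, so that
    W = p - p X p is self-adjoint and its spectral radius equals its norm.  By
    the closed range theorem (a consequence of uniform boundedness) T is bounded
    below on R(T^* ).  Hence a positive X is coercive there, which makes T
    split, and if X is a projection then |W| < 1. *)
Require Import Defs.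
From mathcomp Require Import ring lra.

Set Implicit Arguments.
Unset Strict Implicit.
Unset Printing Implicit Defensive.

(** * Linear maps and real-valued norms *)

(** Adjoints, projections and Moore-Penrose inverses are picked by choice with a default value, so
    each has to be shown to exist before its defining property can be used; hence the projection
    theorem and the Riesz representation on the way. Boundedness of Q_T is not established: p r,
    with r the orthogonal projection onto R(T), is bounded and is exhibited as a Moore-Penrose
    inverse instead. The closed range enters twice: T^* is bounded below on R(T), which makes the
    range of T^* closed, and then the same estimate with the two operators exchanged bounds T below
    on that range. Coercivity of a positive X comes from |X x|^2 <= C <X x, x>, which converts a
    lower bound for |X g| = |T g| into one for <X g, g>. *)

Section LinearMaps.
Context (K : pzRingType) (U V : lmodType K) (A : U -> V).
Hypothesis lA : linear A.

Lemma linear_mapD x y : A (x + y) = A x + A y.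
Proof. by have := lA 1 x y; rewrite !scale1r. Qed.

Lemma linear_map0 : A 0 = 0.
Proof.
have := linear_mapD 0 0; rewrite addr0 => /eqP.
by rewrite eq_sym -subr_eq0 addrK => /eqP.
Qed.

Lemma linear_mapZ a x : A (a *: x) = a *: A x.
Proof. by have := lA a x 0; rewrite linear_map0 !addr0. Qed.

Lemma linear_mapN x : A (- x) = - A x.
Proof. by rewrite -scaleN1r linear_mapZ scaleN1r. Qed.

Lemma linear_mapB x y : A (x - y) = A x - A y.
Proof. by rewrite linear_mapD linear_mapN. Qed.

End LinearMaps.

Section Norm.
Context (R : realType) (H : completeNormedModType R[i]).
Implicit Types (x y : H) (A : H -> H) (M : set H).

(** The norm of [H] takes values in [R[i]]; its real part carries the same information and lives in
    an ordered field open to real arithmetic. *)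
Definition nrm x : R := complex.Re `|x|.

Lemma nrmE x : `|x| = (nrm x)%:C%C.
Proof. by rewrite /nrm RRe_real// normr_real. Qed.

Lemma nrm_ge0 x : 0 <= nrm x.
Proof. by rewrite -ler0c -nrmE. Qed.

Lemma nrm0 : nrm 0 = 0.
Proof. by rewrite /nrm normr0. Qed.

Lemma nrm_eq0 x : nrm x = 0 -> x = 0.
Proof. by move=> x0; apply/eqP; rewrite -normr_eq0 nrmE x0. Qed.

Lemma nrmN x : nrm (- x) = nrm x.
Proof. by rewrite /nrm normrN. Qed.

Lemma nrm_dist x y : nrm (x - y) = nrm (y - x).
Proof. by rewrite -nrmN opprB. Qed.

Lemma nrmD x y : nrm (x + y) <= nrm x + nrm y.
Proof. by rewrite -lecR rmorphD/= -!nrmE ler_normD. Qed.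

Lemma nrm_revB x y : nrm x - nrm y <= nrm (x - y).
Proof. by rewrite lerBlDr (le_trans _ (nrmD _ _))// subrK. Qed.

Lemma nrmZ a x : nrm (a *: x) = complex.Re `|a| * nrm x.
Proof.
by apply: (@complexI R); rewrite rmorphM/= -!nrmE normrZ.
Qed.

Lemma normc_real (r : R) : `|r%:C%C| = `|r|%:C%C.
Proof. by rewrite normc_def/= expr0n addr0 sqrtr_sqr. Qed.

Lemma nrmZr (r : R) x : nrm (r%:C%C *: x) = `|r| * nrm x.
Proof. by rewrite nrmZ normc_real. Qed.

Lemma cvg_nrmP (u : nat -> H) l :
  (u @ \oo --> l) <->
  forall e, 0 < e -> exists N, forall n, (N <= n)%N -> nrm (u n - l) < e.
Proof.
split=> [/cvgrPdist_lt ul e e0|ul].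
  have /ul[N _ uN] : 0 < e%:C%C by rewrite ltcR.
  by exists N => n /uN /=; rewrite nrmE ltcR nrm_dist.
apply/cvgrPdist_lt => e; rewrite ltcE/= => /andP[/eqP ei e0].
have [N uN] := ul _ e0; exists N => // n /= /uN.
by rewrite nrmE ltcE /= nrm_dist ei eqxx.
Qed.

Lemma nrm_cauchy_cvg (u : nat -> H) :
  (forall e, 0 < e -> exists N, forall n m, (N <= n)%N -> (N <= m)%N ->
     nrm (u n - u m) < e) ->
  exists l : H, u @ \oo --> l.
Proof.
move=> uC; suff /cauchy_cvg uc : cauchy (u @ \oo) by exists (lim (u @ \oo)).
apply: cauchy_exP => e; rewrite ltcE/= => /andP[/eqP ei e0].
have [N uN] := uC _ e0; exists (u N), N => // n /= Nn.
by rewrite -ball_normE /= nrmE ltcE /= ei eqxx uN.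
Qed.

Lemma closed_seq M :
  (forall u l, (forall n, M (u n)) -> u @ \oo --> l -> M l) -> closed M.
Proof.
move=> cM l clMl.
have /choice[u uP] : forall n : nat, exists x, M x /\ nrm (x - l) < n.+1%:R^-1.
  move=> n; have n0 : 0 < (n.+1%:R^-1 : R) by rewrite invr_gt0 ltr0n.
  have nB : nbhs l (ball l (n.+1%:R^-1 : R)%:C%C).
    by apply: nbhsx_ballx; rewrite ltcR.
  have [x [Mx]] := clMl _ nB.
  by rewrite -ball_normE /= nrmE ltcR nrm_dist; exists x.
apply: (cM u) => [n|]; first by have [] := uP n.
apply/cvg_nrmP => e e0; exists (Num.truncn e^-1) => n Nn.
have [_ /lt_trans->//] := uP n.
rewrite invf_plt ?posrE ?ltr0n// (lt_le_trans (truncnS_gt _))//.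
by rewrite ler_nat.
Qed.

Lemma bounded_opP A : bounded_op A <->
  linear A /\ exists2 C, 0 < C & forall x, nrm (A x) <= C * nrm x.
Proof.
split=> [[lA cA]|[lA [C C0 AC]]]; split=> //.
  have /cvgrPdist_lt/(_ 1 ltr01)/nbhs_ballP[e /= e0 eA] := cA 0.
  have {}e0 : 0 < e by [].
  move: e0 eA; rewrite ltcE/= => /andP[/eqP ei e0] eA.
  (* Balls are open, so vectors are rescaled to norm [d], strictly inside the radius. *)
  pose d := complex.Re e / 2.
  have d0 : 0 < d by rewrite divr_gt0.
  exists d^-1 => [|x]; first by rewrite invr_gt0.
  have [->|/eqP x0] := eqVneq x 0; first by rewrite linear_map0// nrm0 mulr0.
  have {}x0 : 0 < nrm x.
    by rewrite lt_neqAle nrm_ge0 andbT; apply/eqP => /esym/nrm_eq0.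
  have : ball (0 : H) e ((d / nrm x)%:C%C *: x).
    rewrite -ball_normE /= sub0r normrN nrmE ltcE/= ei eqxx nrmZr.
    rewrite ger0_norm ?divr_ge0 ?ltW// divfK ?gt_eqF//.
    by rewrite /d ltr_pdivrMr// ltr_pMr// ltr1n.
  move/eA; rewrite /= linear_map0// sub0r normrN linear_mapZ// nrmE.
  rewrite (ltcR _ 1) nrmZr ger0_norm ?(divr_ge0 (ltW _) (ltW _))// => /ltW.
  by rewrite mulrAC ler_pdivrMr// mul1r ler_pdivlMl.
move=> x; apply/cvgrPdist_lt => e; rewrite ltcE/= => /andP[/eqP ei e0].
apply/nbhs_ballP; exists (complex.Re e / C)%:C%C => /=.
  by rewrite /= ltcR divr_gt0.
move=> y; rewrite -ball_normE /= -linear_mapB// !nrmE ltcR ltcE/= ei eqxx/=.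
by rewrite ltr_pdivlMr// mulrC; apply: le_lt_trans.
Qed.

Lemma bounded_op_comp A B : bounded_op A -> bounded_op B -> bounded_op (A \o B).
Proof.
move=> [lA cA] [lB cB]; split=> [a x y /=|x]; first by rewrite lB lA.
by apply: continuous_comp; [exact: cB|exact: cA].
Qed.

Lemma bounded_opB A B :
  bounded_op A -> bounded_op B -> bounded_op (fun x => A x - B x).
Proof.
move=> [lA cA] [lB cB]; split=> [a x y /=|x].
  by rewrite lB lA scalerBr opprD addrACA.
by apply: cvgB; [exact: cA|exact: cB].
Qed.

Lemma bounded_opZ (a : R[i]) : bounded_op (fun x : H => a *: x).
Proof.
split=> [b x y|x]; first by rewrite scalerDr !scalerA mulrC.
exact: scaler_continuous.
Qed.

Lemma bounded_op_id : bounded_op (@id H).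
Proof. by split=> // x; exact: cvg_id. Qed.

Definition subspace M := M 0 /\ forall a x y, M x -> M y -> M (a *: x + y).

Section Subspace.
Variable M : set H.
Hypothesis sM : subspace M.

Lemma subspaceD x y : M x -> M y -> M (x + y).
Proof. by move=> Mx My; rewrite -(scale1r x); apply: sM.2. Qed.

Lemma subspaceZ a x : M x -> M (a *: x).
Proof.
by move=> Mx; rewrite -(addr0 (_ *: _)); apply: sM.2 => //; exact: sM.1.
Qed.

Lemma subspaceB x y : M x -> M y -> M (x - y).
Proof.
by move=> Mx My; apply: subspaceD => //; rewrite -scaleN1r; exact: subspaceZ.
Qed.

Lemma subspace_image A : linear A -> subspace (A @` M).
Proof.
move=> lA; split; first by exists 0; [exact: sM.1|exact: linear_map0].
move=> a _ _ [x Mx <-] [y My <-]; exists (a *: x + y); first exact: sM.2.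
exact: lA.
Qed.

End Subspace.

Lemma subspace_setT : subspace setT. Proof. by []. Qed.

Lemma subspace_range A : linear A -> subspace (range A).
Proof. exact/subspace_image/subspace_setT. Qed.

(** The lower bound makes preimages in [M] of a convergent sequence Cauchy; completeness gives them
    a limit. *)
Lemma closed_image_bounded_below A M c : bounded_op A -> closed M ->
  subspace M -> 0 < c -> (forall x, M x -> c * nrm x <= nrm (A x)) ->
  closed (A @` M).
Proof.
move=> [lA cA] clM sM c0 Ac; apply: closed_seq => v l Mv vl.
have /choice[u uP] : forall n, exists x, M x /\ A x = v n.
  by move=> n; have [x] := Mv n; exists x.
have [|x ux] := @nrm_cauchy_cvg u.
  move=> e e0; have ce0 : 0 < c * e / 2 by rewrite divr_gt0// mulr_gt0.
  have /cvg_nrmP/(_ _ ce0)[N vN] := vl; exists N => n m Nn Nm.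
  have [Mn An] := uP n; have [Mm Am] := uP m.
  rewrite -(ltr_pM2l c0) (le_lt_trans (Ac _ (subspaceB sM Mn Mm)))//.
  rewrite linear_mapB// An Am -(subrK l (v n)) -addrA.
  rewrite (le_lt_trans (nrmD _ _))// [c * e]splitr ltrD ?vN// nrm_dist.
  exact: vN.
have Mx : M x by apply: closed_cvg ux => //; apply: nearW => n; have [] := uP n.
exists x => //; apply: (cvg_unique _ _ vl) => //.
have -> : v = A \o u by apply/funext => n /=; rewrite (uP n).2.
by apply: cvg_comp ux _; exact: cA.
Qed.

End Norm.

(** * Inner products and the projection theorem *)

Section InnerProduct.
Context (R : realType) (H : completeNormedModType R[i]).
Variable ip : {dot H for (@Num.conj R[i])}.
Hypothesis ipH : inner_product_norm ip.
Implicit Types (x y z : H) (A B : H -> H) (M : set H).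

Lemma ipC x y : ip x y = (ip y x)^*%C.
Proof. by rewrite (hermC ip) expr0 mul1r. Qed.

Lemma ipDl x y z : ip (x + y) z = ip x z + ip y z.
Proof. exact: linearDl. Qed.

Lemma ipDr x y z : ip x (y + z) = ip x y + ip x z.
Proof. exact: linearDr. Qed.

Lemma ipBl x y z : ip (x - y) z = ip x z - ip y z.
Proof. exact: linearBl. Qed.

Lemma ipBr x y z : ip x (y - z) = ip x y - ip x z.
Proof. exact: linearBr. Qed.

Lemma ipZl a x y : ip (a *: x) y = a * ip x y.
Proof. exact: linearZl_LR. Qed.

Lemma ipZr a x y : ip x (a *: y) = a^*%C * ip x y.
Proof. exact: linearZr_LR. Qed.

Lemma ip0l x : ip 0 x = 0.
Proof. exact: linear0l. Qed.

Lemma ip0r x : ip x 0 = 0.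
Proof. exact: linear0r. Qed.

Definition rip x y : R := complex.Re (ip x y).

Lemma ripC x y : rip x y = rip y x.
Proof. by rewrite /rip ipC; case: (ip y x). Qed.

Lemma ripDl x y z : rip (x + y) z = rip x z + rip y z.
Proof. by rewrite /rip ipDl raddfD. Qed.

Lemma ripDr x y z : rip x (y + z) = rip x y + rip x z.
Proof. by rewrite /rip ipDr raddfD. Qed.

Lemma ripBl x y z : rip (x - y) z = rip x z - rip y z.
Proof. by rewrite /rip ipBl raddfB. Qed.

Lemma ripBr x y z : rip x (y - z) = rip x y - rip x z.
Proof. by rewrite /rip ipBr raddfB. Qed.

Lemma ripZl (r : R) x y : rip (r%:C%C *: x) y = r * rip x y.
Proof. by rewrite /rip ipZl; case: (ip x y) => a b /=; rewrite mul0r subr0. Qed.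

Lemma ripZr (r : R) x y : rip x (r%:C%C *: y) = r * rip x y.
Proof. by rewrite ripC ripZl ripC. Qed.

Lemma ripxx x : rip x x = nrm x ^+ 2.
Proof.
by apply: complexI; rewrite rmorphXn/= -nrmE ipH /rip RRe_real// -ipH realX.
Qed.

Lemma ipxx x : ip x x = (nrm x ^+ 2)%:C%C.
Proof. by rewrite -ipH nrmE rmorphXn. Qed.

Lemma nrm_sqrD x y : nrm (x + y) ^+ 2 = nrm x ^+ 2 + 2 * rip x y + nrm y ^+ 2.
Proof. by rewrite -!ripxx ripDl !ripDr (ripC y x); ring. Qed.

Lemma nrm_sqrB x y : nrm (x - y) ^+ 2 = nrm x ^+ 2 - 2 * rip x y + nrm y ^+ 2.
Proof. by rewrite -!ripxx ripBl !ripBr (ripC y x); ring. Qed.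

Lemma nrm_le x y : nrm x ^+ 2 <= nrm y ^+ 2 -> nrm x <= nrm y.
Proof. by rewrite ler_pXn2r ?nnegrE ?nrm_ge0. Qed.

Lemma rip_le x y : rip x y <= nrm x * nrm y.
Proof.
have [y0|y0] := eqVneq (nrm y) 0.
  by rewrite (nrm_eq0 y0) /rip ip0r nrm0 mulr0.
have {}y0 : 0 < nrm y by rewrite lt_neqAle eq_sym y0 nrm_ge0.
have [x0|x0] := eqVneq (nrm x) 0.
  by rewrite (nrm_eq0 x0) /rip ip0l nrm0 mul0r.
have {}x0 : 0 < nrm x by rewrite lt_neqAle eq_sym x0 nrm_ge0.
have := sqr_ge0 (nrm ((nrm y)%:C%C *: x - (nrm x)%:C%C *: y)).
rewrite nrm_sqrB !nrmZr ripZl ripZr !ger0_norm ?nrm_ge0// => h.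
have {}h : 0 <= (nrm x * nrm y) * (nrm x * nrm y - rip x y) by lra.
by move: h; rewrite pmulr_rge0 ?mulr_gt0// subr_ge0.
Qed.

Lemma normr_rip_le x y : `|rip x y| <= nrm x * nrm y.
Proof.
rewrite ler_norml rip_le andbT lerNl -nrmN (le_trans _ (rip_le _ _))//.
by rewrite -(sub0r x) ripBl /rip ip0l sub0r.
Qed.

Lemma norm_ip_le x y : `|ip x y| <= (nrm x * nrm y)%:C%C.
Proof.
have [->|n0] := eqVneq (ip x y) 0.
  by rewrite normr0 ler0c mulr_ge0 ?nrm_ge0.
pose a := `|ip x y| / ip x y.
have a1 : `|a| = 1 by rewrite normrM normr_id normfV divff// normr_eq0.
have axy : ip (a *: x) y = `|ip x y| by rewrite ipZl divfK.
have := rip_le (a *: x) y.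
by rewrite nrmZ a1 mul1r -lecR /rip axy RRe_real// normr_real.
Qed.

(** The imaginary part of <x, y> is the real part of <x, i y>, and [M] contains i y along with y. *)
Lemma subspace_rip_orth M x : subspace M ->
  (forall y, M y -> rip x y = 0) -> orth_compl ip M x.
Proof.
move=> sM xM y My.
have r0 := xM _ My; have i0 := xM _ (subspaceZ sM 'i%C My).
move: r0 i0; rewrite /rip ipZr; case: (ip x y) => a b /= -> /eqP.
by rewrite mul0r sub0r mulN1r opprK => /eqP->.
Qed.

Lemma ip_continuousl y : continuous (ip^~ y).
Proof.
move=> x; apply/cvgrPdist_lt => e; rewrite ltcE/= => /andP[/eqP ei e0].
have ny : 0 < nrm y + 1 by rewrite ltr_wpDl ?nrm_ge0.
apply/nbhs_ballP; exists (complex.Re e / (nrm y + 1))%:C%C => /=.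
  by rewrite ltcR divr_gt0.
move=> z; rewrite -ball_normE /= nrmE ltcR => xz; rewrite -ipBl.
apply: le_lt_trans (norm_ip_le _ _) _; rewrite ltcE/= ei eqxx/=.
rewrite ltr_pdivlMr// in xz; apply: le_lt_trans xz.
by rewrite ler_wpM2l ?nrm_ge0// lerDl.
Qed.

Lemma ipxx_eq0 x : ip x x = 0 -> x = 0.
Proof. by rewrite ipxx => -[] /eqP; rewrite expf_eq0 => /eqP/nrm_eq0. Qed.

Lemma closed_orth_compl M : closed (orth_compl ip M).
Proof.
apply: closed_seq => u l Mu ul y My.
have uy : (ip^~ y \o u) @ \oo --> ip l y.
  by apply: cvg_comp ul _; exact: ip_continuousl.
apply: (@cvg_unique _ (@norm_hausdorff _ R[i]^o) _ _ _ _ uy).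
rewrite (_ : _ \o u = cst 0); first exact: cvg_cst.
by apply/funext => n /=; rewrite Mu.
Qed.

Lemma subspace_orth_compl M : subspace (orth_compl ip M).
Proof.
split=> [y _|a x y Mx My z Mz]; first exact: ip0l.
by rewrite ipDl ipZl Mx// My// mulr0 addr0.
Qed.

Lemma orth_compl_disjoint M x : M x -> orth_compl ip M x -> x = 0.
Proof. by move=> Mx /(_ _ Mx)/ipxx_eq0. Qed.

Lemma orth_complC M x y : M x -> orth_compl ip M y -> ip x y = 0.
Proof. by move=> Mx My; rewrite ipC My//; rewrite conjc0. Qed.

(** A sequence in [M] minimizing the distance to [x] is Cauchy by the parallelogram identity; a
    first variation at its limit gives orthogonality. *)
Lemma projection_exists M x : subspace M -> closed M ->
  exists2 y, M y & orth_compl ip M (x - y).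
Proof.
move=> sM cM.
pose D : set R := [set nrm (x - m) ^+ 2 | m in M].
have D0 : D !=set0 by exists (nrm (x - 0) ^+ 2), 0 => //; exact: sM.1.
have lD : has_lbound D by exists 0 => _ [m _ <-]; exact: sqr_ge0.
have iD : has_inf D by [].
pose d := inf D.
have dle m : M m -> d <= nrm (x - m) ^+ 2.
  by move=> Mm; apply: ge_inf => //; exists m.
have /choice[u uP] : forall n : nat,
    exists m, M m /\ nrm (x - m) ^+ 2 < d + n.+1%:R^-1.
  move=> n; have n0 : 0 < (n.+1%:R^-1 : R) by rewrite invr_gt0 ltr0n.
  by have [_ [m Mm <-] dm] := inf_adherent n0 iD; exists m.
have par a b : M a -> M b ->
    nrm (a - b) ^+ 2 <= 2 * (nrm (x - a) ^+ 2 - d) + 2 * (nrm (x - b) ^+ 2 - d).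
  move=> Ma Mb.
  (* The midpoint lies in [M], so its squared distance to [x] is at least [d]. *)
  have Mab : M ((2^-1)%:C%C *: (a + b)).
    by apply: subspaceZ => //; exact: subspaceD.
  have := dle _ Mab.
  rewrite !nrm_sqrB nrmZr ripZr ripDr normfV ger0_norm// exprMn nrm_sqrD; lra.
have [|l ul] := @nrm_cauchy_cvg R H u.
  move=> e e0; exists (Num.truncn (4 / e ^+ 2)) => n m Nn Nm.
  have small k : (Num.truncn (4 / e ^+ 2) <= k)%N -> k.+1%:R^-1 < e ^+ 2 / 4.
    move=> Nk; rewrite invf_plt ?posrE ?ltr0n ?divr_gt0 ?exprn_gt0// invf_div.
    by rewrite (lt_le_trans (truncnS_gt _))// ler_nat.
  have [Mn dn] := uP n; have [Mm dm] := uP m.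
  rewrite -(@ltr_pXn2r _ 2) ?nnegrE ?nrm_ge0 ?(ltW e0)//.
  move: dn dm (par _ _ Mn Mm) (small _ Nn) (small _ Nm).
  by move: (n.+1%:R^-1) (m.+1%:R^-1) => p q; lra.
have Ml : M l by apply: closed_cvg ul => //; apply: nearW => n; have [] := uP n.
exists l => //.
have dl : nrm (x - l) ^+ 2 <= d.
  have d0 : 0 <= d by apply: lb_le_inf => // _ [m _ <-]; exact: sqr_ge0.
  rewrite leNgt; apply/negP => dl.
  pose a := nrm (x - l); pose s := Num.sqrt d.
  have sa : s < a.
    rewrite /a -(ger0_norm (nrm_ge0 (x - l))) -sqrtr_sqr ltr_sqrt//.
    exact: le_lt_trans dl.
  (* Two errors of size [e] fit strictly between [s] and [a]: one for |x - u n| against [s], one for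
     |u n - l|. *)
  pose e := (a - s) / 3.
  have e0 : 0 < e by rewrite divr_gt0// subr_gt0.
  have /cvg_nrmP/(_ _ e0)[N uN] := ul.
  pose n := maxn N (Num.truncn (e ^- 2)).
  have un := uN _ (leq_maxl _ _ : (N <= n)%N).
  have [Mn dn] := uP n.
  have ne : n.+1%:R^-1 < e ^+ 2.
    rewrite invf_plt ?posrE ?ltr0n ?exprn_gt0//.
    by rewrite (lt_le_trans (truncnS_gt _))// ler_nat ltnS leq_maxr.
  have xu : nrm (x - u n) < s + e.
    rewrite -(@ltr_pXn2r _ 2) ?nnegrE ?nrm_ge0 ?addr_ge0 ?sqrtr_ge0 ?(ltW e0)//.
    have : 0 <= s * e by rewrite mulr_ge0 ?sqrtr_ge0 ?(ltW e0).
    have : s ^+ 2 = d by rewrite sqr_sqrtr.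
    by move: dn ne; move: (n.+1%:R^-1) => p; rewrite sqrrD mulr2n; lra.
  have : a <= nrm (x - u n) + nrm (u n - l).
    by rewrite (le_trans _ (nrmD _ _))// addrA subrK.
  by rewrite /e in un xu; lra.
apply: subspace_rip_orth => // y My.
have var t : nrm (x - l) ^+ 2 <=
    nrm (x - l) ^+ 2 - 2 * t * rip (x - l) y + t ^+ 2 * nrm y ^+ 2.
  have Mt := subspaceD sM Ml (subspaceZ sM t%:C%C My).
  rewrite (le_trans dl)// (le_trans (dle _ Mt))//.
  rewrite opprD addrA (nrm_sqrB (x - l)) ripZr nrmZr exprMn.
  rewrite real_normK ?num_real//.
  by rewrite lerD2r lerD2l mulrA.
have [y0|y0] := eqVneq (nrm y) 0; first by rewrite (nrm_eq0 y0) /rip ip0r.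
(* This value of t minimizes the quadratic in [var], where the gain is r^2 / |y|^2. *)
have := var (rip (x - l) y / nrm y ^+ 2).
set r := rip _ _; rewrite -mulrA (mulrC (r / _)) exprMn exprVn => h.
have {}h : r ^+ 2 / nrm y ^+ 2 <= 0.
  have -> : r ^+ 2 / nrm y ^+ 2 = 2 * (r * (r / nrm y ^+ 2)) -
      r ^+ 2 * (nrm y ^+ 2) ^-2 * nrm y ^+ 2 by field.
  lra.
move: h; rewrite pmulr_lle0 ?invr_gt0 ?exprn_even_gt0//.
by move=> h; apply/eqP; rewrite -sqrf_eq0 eq_le h sqr_ge0.
Qed.

End InnerProduct.

(** * Adjoints and uniform boundedness *)

Section Adjoint.
Context (R : realType) (H : completeNormedModType R[i]).
Variable ip : {dot H for (@Num.conj R[i])}.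
Hypothesis ipH : inner_product_norm ip.
Implicit Types (x y z : H) (A B S : H -> H) (M : set H).

(** For [M] a range this is convertible with [orth_proj_range]. *)
Definition oproj M : H -> H := proj_along M (orth_compl ip M).

Section ClosedSubspace.
Variable M : set H.
Hypotheses (sM : subspace M) (cM : closed M).

Lemma oprojP x : M (oproj M x) /\ orth_compl ip M (x - oproj M x).
Proof.
have [y My xy] := projection_exists ipH x sM cM.
by apply: (@xgetPex _ 0 [set y | M y /\ orth_compl ip M (x - y)]); exists y.
Qed.

Lemma oproj_unique x y : M y -> orth_compl ip M (x - y) -> oproj M x = y.
Proof.
move=> My xy; have [Mx xx] := oprojP x.
apply/eqP; rewrite -subr_eq0; apply/eqP.
apply: (orth_compl_disjoint ipH (subspaceB sM Mx My)).
rewrite (_ : _ - _ = (x - y) - (x - oproj M x)); last first.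
  by rewrite opprB [RHS]addrC addrA subrK.
exact: (subspaceB (subspace_orth_compl ip M)).
Qed.

Lemma oproj_id x : M x -> oproj M x = x.
Proof.
by move=> Mx; apply: oproj_unique => //; rewrite subrr => y _; exact: ip0l.
Qed.

Lemma oproj_eq0 x : orth_compl ip M x -> oproj M x = 0.
Proof. by move=> xM; apply: oproj_unique; rewrite ?subr0//; exact: sM.1. Qed.

Lemma linear_oproj : linear (oproj M).
Proof.
move=> a x y; have [Mx xx] := oprojP x; have [My yy] := oprojP y.
apply: oproj_unique; first exact: sM.2.
by rewrite opprD addrACA -scalerBr; exact: (subspace_orth_compl ip M).2.
Qed.

Lemma oproj_ip x y : ip (oproj M x) y = ip (oproj M x) (oproj M y).
Proof.
have [Mx xx] := oprojP x; have [My yy] := oprojP y.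
by apply/eqP; rewrite -subr_eq0 -ipBr (orth_complC Mx yy).
Qed.

Lemma oproj_sym x y : ip (oproj M x) y = ip x (oproj M y).
Proof. by rewrite oproj_ip (ipC ip x) [in RHS]oproj_ip -ipC. Qed.

Lemma nrm_oproj x : nrm (oproj M x) <= nrm x.
Proof.
apply: nrm_le; have [Mx xx] := oprojP x.
rewrite -[in leRHS](subrK (oproj M x) x) (nrm_sqrD ipH) /rip xx// mulr0 addr0.
by rewrite lerDr sqr_ge0.
Qed.

Lemma bounded_oproj : bounded_op (oproj M).
Proof.
apply/bounded_opP; split; first exact: linear_oproj.
by exists 1 => // x; rewrite mul1r nrm_oproj.
Qed.

End ClosedSubspace.

(** Stating adjointness as a relation keeps the choice inside [adjoint] out of computations. *)
Definition adjoint_pair A B := forall x y, ip (A x) y = ip x (B y).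

Lemma adjoint_pairC A B : adjoint_pair A B -> adjoint_pair B A.
Proof. by move=> AB x y; rewrite ipC -AB -ipC. Qed.

Lemma ip_inj y z : (forall x, ip x y = ip x z) -> y = z.
Proof.
move=> yz; apply/eqP; rewrite -subr_eq0; apply/eqP/(ipxx_eq0 ipH).
by rewrite ipBr yz subrr.
Qed.

Lemma adjoint_unique A B : adjoint_pair A B -> adjoint ip A = B.
Proof.
move=> AB; apply/funext => y; apply: xget_unique => [x|z Az]; first exact: AB.
by apply: ip_inj => x; rewrite -Az AB.
Qed.

(** Continuity is stated as a closed kernel because, for x |-> <A x, y>, the kernel is a preimage
    under [A] of an orthogonal complement. *)
Lemma riesz (f : H -> R[i]) : (forall a x y, f (a *: x + y) = a * f x + f y) ->
  closed [set x | f x = 0] -> exists z, forall x, f x = ip x z.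
Proof.
move=> lf cK.
have f0 : f 0 = 0.
  have := lf 1 0 0; rewrite scaler0 addr0 mul1r => /eqP.
  by rewrite eq_sym -subr_eq0 addrK => /eqP.
have sK : subspace [set x | f x = 0].
  by split=> //= a x y fx fy; rewrite lf fx fy mulr0 addr0.
have [fz|/existsNP[x0 fx0]] := pselect (forall x, f x = 0).
  by exists 0 => x; rewrite fz ip0r.
pose w := x0 - oproj [set x | f x = 0] x0.
have [Kp Kw] := oprojP sK cK x0; rewrite -/w in Kw.
have fw : f w != 0.
  apply/eqP => fw; apply: fx0.
  rewrite -(subrK (oproj [set x | f x = 0] x0) x0) -[_ - _]scale1r.
  by rewrite lf fw Kp mulr0 addr0.
have w0 : ip w w != 0.
  by apply: contraNneq fw => /(ipxx_eq0 ipH) ->; rewrite f0.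
exists ((f w / ip w w)^*%C *: w) => x.
(* Pairing this element of the kernel with [w], which is orthogonal to the kernel, yields f x as a
   multiple of <x, w>. *)
have Kx : f (f w *: x + (- f x) *: w) = 0.
  by rewrite lf -(addr0 (_ *: w)) lf f0 addr0 mulrC mulNr subrr.
have := orth_complC Kx Kw; rewrite ipDl !ipZl => /eqP.
rewrite mulNr subr_eq0 => /eqP h.
by rewrite ipZr conjcK mulrAC h mulfK.
Qed.

Lemma adjointP A : bounded_op A -> adjoint_pair A (adjoint ip A).
Proof.
move=> [lA cA] x y; have [|//|z Az] := @riesz (fun x => ip (A x) y).
- by move=> a u v; rewrite lA ipDl ipZl.
- rewrite (_ : mkset _ = A @^-1` orth_compl ip [set y]).
    by move/continuous_closedP : cA; apply; exact: closed_orth_compl.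
  by apply/seteqP; split=> u /= Au; [move=> _ ->|exact: Au].
- have : [set z | forall x, ip (A x) y = ip x z] (adjoint ip A y).
    by apply: (xgetPex 0); exists z.
  exact.
Qed.

(** From |B x|^2 = <A (B x), x> <= C |B x| |x|, a factor |B x| cancels. *)
Lemma bounded_adjoint A B : bounded_op A -> adjoint_pair A B -> bounded_op B.
Proof.
move=> /bounded_opP[lA [C C0 AC]] AB; apply/bounded_opP; split=> [a x y|].
  apply: ip_inj => z.
  by rewrite -AB !ipDr !ipZr !AB.
exists C => // x; have [->|Bx] := eqVneq (nrm (B x)) 0.
  by rewrite mulr_ge0 ?nrm_ge0 ?ltW.
rewrite -(@ler_pM2l _ (nrm (B x))) ?lt_neqAle ?nrm_ge0 1?eq_sym ?Bx//.
rewrite -expr2 -(ripxx ipH) /rip -AB mulrCA mulrA.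
by rewrite (le_trans (rip_le ipH _ _))// ler_wpM2r ?nrm_ge0.
Qed.

(* Gliding hump: along vectors y_n of norm more than 4^n, the steps
   +- 3^-n y_n/|y_n| lead to a limit l with |<l, y_n>| >= 3^-n |y_n| / 2. *)
Lemma weakly_bounded (Y : set H) :
  (forall x, exists K, forall y, Y y -> rip ip x y <= K) ->
  exists K, forall y, Y y -> nrm y <= K.
Proof.
move=> wY; apply: contrapT => nY.
have /choice[y yP] : forall n : nat, exists y, Y y /\ 4 ^+ n < nrm y.
  move=> n; apply: contrapT => ny; apply: nY; exists (4 ^+ n) => y Yy.
  by rewrite leNgt; apply/negP => ?; apply: ny; exists y.
(* With ratio 1/3 all steps after the n-th add up to at most half of the n-th, while 4^n t n =
   (4/3)^n still diverges. *)
pose t n : R := 3^-1 ^+ n.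
have t0 n : 0 < t n by rewrite exprn_gt0// invr_gt0.
pose h n : H := (t n / nrm (y n))%:C%C *: y n.
have y0 n : 0 < nrm (y n) by rewrite (lt_trans _ (yP n).2)// exprn_gt0.
have hn n : nrm (h n) = t n.
  rewrite nrmZr ger0_norm ?divr_ge0 ?(ltW (t0 n)) ?(ltW (y0 n))//.
  by rewrite divfK// gt_eqF.
have hy n : rip ip (h n) (y n) = t n * nrm (y n).
  by rewrite ripZl (ripxx ipH) expr2 mulrA divfK// gt_eqF.
(* The sign makes the new step reinforce, never cancel, the value already paired with [y n]. *)
pose sg (x : H) n : R := if rip ip x (y n) < 0 then -1 else 1.
pose x := fix x n := if n is k.+1 then x k + (sg (x k) n)%:C%C *: h n else 0.
have xS n : x n.+1 = x n + (sg (x n) n.+1)%:C%C *: h n.+1 by [].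
have sg1 z n : `|sg z n| = 1 by rewrite /sg; case: ifP; rewrite ?normrN normr1.
have dist n m : nrm (x (n + m)%N - x n) <= (t n - t (n + m)%N) / 2.
  elim: m => [|m IH]; first by rewrite addn0 !subrr nrm0 mul0r.
  rewrite addnS xS addrAC (le_trans (nrmD _ _))// nrmZr sg1 mul1r hn.
  have : t (n + m).+1 = t (n + m)%N / 3 by rewrite /t exprSr.
  lra.
have tle n m : (n <= m)%N -> t m <= t n.
  by move=> nm; rewrite ler_wiXn2l// ?invr_ge0// invf_le1// ler1n.
have tsmall e : 0 < e -> exists N, t N < e.
  move=> e0; exists (Num.truncn e^-1).+1.
  rewrite /t exprVn invf_plt ?posrE ?exprn_gt0//.
  by rewrite (lt_le_trans (truncnS_gt _))// -natrX ler_nat ltnW// ltn_expl.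
have [|l xl] := @nrm_cauchy_cvg R H x.
  move=> e e0; have [N tN] := tsmall _ e0; exists N => n m Nn Nm.
  have := dist N (n - N)%N; have := dist N (m - N)%N.
  rewrite !subnKC// => dm dn.
  rewrite -(subrK (x N) (x n)) -addrA (le_lt_trans (nrmD _ _))//.
  rewrite (nrm_dist (x N)); have := t0 n; have := t0 m; lra.
have ln n : nrm (l - x n) <= t n / 2.
  rewrite leNgt; apply/negP => lt.
  have /cvg_nrmP/(_ (nrm (l - x n) - t n / 2))[|N xN] := xl.
    by rewrite subr_gt0.
  have := xN _ (leq_addl n N); have := dist n N; have := t0 (n + N)%N.
  have := nrmD (l - x (n + N)%N) (x (n + N)%N - x n).
  rewrite addrA subrK (nrm_dist l (x (n + N)%N)); lra.
have big n : t n.+1 * nrm (y n.+1) <= `|rip ip (x n.+1) (y n.+1)|.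
  have ty : 0 <= t n.+1 * nrm (y n.+1) by rewrite mulr_ge0// ltW.
  rewrite xS ripDl ripZl hy /sg; case: ltP => s0.
    by rewrite ler0_norm; lra.
  by rewrite ger0_norm; lra.
(* The hypothesis bounds from above only; applying it to [- l] too bounds the absolute value. *)
have [K1 K1P] := wY l; have [K2 K2P] := wY (- l).
have K n : 2^-1 * (4 / 3) ^+ n.+1 <= `|K1| + `|K2|.
  have [Yn yn] := yP n.+1.
  have e1 : t n.+1 * nrm (y n.+1) / 2 <= `|rip ip l (y n.+1)|.
    have := big n; have := ln n.+1.
    have := normr_rip_le ipH (l - x n.+1) (y n.+1); rewrite ripBl distrC.
    have := ler_dist_dist (rip ip (x n.+1) (y n.+1)) (rip ip l (y n.+1)).
    have := ler_norm (`|rip ip (x n.+1) (y n.+1)| - `|rip ip l (y n.+1)|).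
    move: (`|_ - `| _ | |) => a ? ? h1 h2 h3.
    have : nrm (l - x n.+1) * nrm (y n.+1) <= t n.+1 / 2 * nrm (y n.+1).
      by rewrite ler_wpM2r ?nrm_ge0.
    lra.
  have e2 : `|rip ip l (y n.+1)| <= `|K1| + `|K2|.
    rewrite ler_norml; apply/andP; split.
      rewrite lerNl; have := K2P _ Yn; rewrite -(sub0r l) ripBl /rip ip0l sub0r.
      have := ler_norm K2; have := normr_ge0 K1; lra.
    have := K1P _ Yn; have := ler_norm K1; have := normr_ge0 K2; lra.
  rewrite (le_trans _ e2)// (le_trans _ e1)// mulrC ler_wpM2r//.
  by rewrite exprMn mulrC /t ler_wpM2l ?(ltW yn)// ltW.
pose B := `|K1| + `|K2|.
have bern n : 1 + n%:R / 3 <= (4 / 3 : R) ^+ n.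
  elim: n => [|n IH]; first by rewrite mul0r addr0 expr0.
  have n0 : 0 <= (n%:R : R) by rewrite ler0n.
  by rewrite exprSr -natr1; move: IH n0; move: (n%:R) (_ ^+ n) => a b; lra.
(* The factor 6 offsets the 1/2 in [K] times the 1/3 in [bern]. *)
pose N := Num.truncn (6 * B).
have := K N; have := bern N.+1; have := truncnS_gt (6 * B); rewrite -/N -/B.
by move: (N.+1%:R) (_ ^+ N.+1) => a b; lra.
Qed.

End Adjoint.

(** * The closed range theorem *)

Section ClosedRange.
Context (R : realType) (H : completeNormedModType R[i]).
Variable ip : {dot H for (@Num.conj R[i])}.
Hypothesis ipH : inner_product_norm ip.
Variables A B : H -> H.
Hypotheses (bA : bounded_op A) (bB : bounded_op B).
Hypothesis AB : adjoint_pair ip A B.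

Lemma kernel_orth_range x : orth_compl ip (range A) x -> B x = 0.
Proof.
by move=> xA; apply: (ip_inj ipH) => z; rewrite ip0r -AB ipC xA ?conjc0.
Qed.

Lemma range_orth_kernel x : range B x -> orth_compl ip (kernel A) x.
Proof. by move=> [z _ <-] y Ay; rewrite ipC -AB Ay ip0l conjc0. Qed.

(* The vectors y of range A with |B y| <= 1 form a weakly bounded set, since
   <A u, y> = <u, B y>. *)
Lemma adjoint_bounded_below : closed (range A) ->
  exists2 c, 0 < c & forall y, range A y -> c * nrm y <= nrm (B y).
Proof.
move=> cA; have sA := subspace_range bA.1.
have [|K KP] := @weakly_bounded R H ip ipH
    [set y | range A y /\ nrm (B y) <= 1].
  move=> x; have [[u _ ux] xx] := oprojP ipH sA cA x.
  exists (nrm u) => y [Ay By].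
  rewrite -(subrK (oproj ip (range A) x) x) ripDl /rip xx// add0r -ux AB.
  by rewrite (le_trans (rip_le ipH _ _))// ler_piMr// nrm_ge0.
pose L := `|K| + 1; have L0 : 0 < L by rewrite ltr_wpDl.
exists L^-1; rewrite ?invr_gt0// => y Ay.
rewrite leNgt; apply/negP => lt.
have y0 : 0 < nrm y.
  rewrite -(pmulr_rgt0 _ (_ : 0 < L^-1)) ?invr_gt0//.
  by rewrite (le_lt_trans _ lt)// nrm_ge0.
have Ly : 0 <= L / nrm y by rewrite divr_ge0// ltW.
(* Rescaled to norm [L] > [K], a violating [y] still has image of norm at most 1. *)
have := KP ((L / nrm y)%:C%C *: y).
rewrite nrmZr (ger0_norm Ly) divfK ?gt_eqF//.
suff: range A ((L / nrm y)%:C%C *: y) /\ nrm (B ((L / nrm y)%:C%C *: y)) <= 1.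
  by move=> h /(_ h); rewrite /L; have := ler_norm K; lra.
split; first exact: subspaceZ.
rewrite (linear_mapZ bB.1) nrmZr (ger0_norm Ly) mulrAC ler_pdivrMr// mul1r.
by rewrite -ler_pdivlMl// ltW.
Qed.

(** [B] vanishes on the orthogonal complement of the range of [A], so its range is the image of that
    closed range, where [B] is bounded below. *)
Lemma closed_range_adjoint : closed (range A) -> closed (range B).
Proof.
move=> cA; have sA := subspace_range bA.1.
have [c c0 cP] := adjoint_bounded_below cA.
rewrite (_ : range B = B @` range A).
  exact: closed_image_bounded_below cP.
apply/seteqP; split=> [_ [x _ <-]|_ [x _ <-]]; last by exists x.
have [Ax xx] := oprojP ipH sA cA x; exists (oproj ip (range A) x) => //.
by apply/esym/eqP; rewrite -subr_eq0 -(linear_mapB bB.1) kernel_orth_range.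
Qed.

Lemma orth_kernel_range x : closed (range A) ->
  orth_compl ip (kernel A) x -> range B x.
Proof.
move=> /closed_range_adjoint cB xA; have sB := subspace_range bB.1.
have [Bx xx] := oprojP ipH sB cB x.
suff -> : x = oproj ip (range B) x by [].
apply/eqP; rewrite -subr_eq0; apply/eqP.
apply: (orth_compl_disjoint ipH (M := kernel A)).
  by apply: (ip_inj ipH) => z; rewrite ip0r ipC AB xx ?conjc0.
by apply: (subspaceB (subspace_orth_compl _ _)) => //; exact: range_orth_kernel.
Qed.

End ClosedRange.

(** * Self-adjoint operators: spectral radius and norm *)

Section Spectrum.
Context (R : realType) (H : completeNormedModType R[i]).
Variable ip : {dot H for (@Num.conj R[i])}.
Hypothesis ipH : inner_product_norm ip.
Variable W : H -> H.
Hypotheses (bW : bounded_op W) (sW : adjoint_pair ip W W).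

Lemma opnorm_bound c : (opnorm W <= c%:E)%E -> forall x, nrm (W x) <= c * nrm x.
Proof.
move=> Wc x; have [->|/eqP x0] := eqVneq x 0.
  by rewrite (linear_map0 bW.1) nrm0 mulr0.
have {}x0 : 0 < nrm x.
  by rewrite lt_neqAle nrm_ge0 andbT; apply/eqP => /esym/nrm_eq0.
rewrite -ler_pdivrMr// mulrC -[X in X * _]ger0_norm ?invr_ge0 ?nrm_ge0//.
rewrite -nrmZr -(linear_mapZ bW.1) -lee_fin (le_trans _ Wc)//.
apply: ereal_sup_ubound; exists ((nrm x)^-1%:C%C *: x) => //=.
by rewrite nrmE (lecR _ 1) nrmZr ger0_norm ?invr_ge0 ?nrm_ge0// mulVf// gt_eqF.
Qed.

Lemma opnorm_le c : 0 <= c -> (forall x, nrm (W x) <= c * nrm x) ->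
  (opnorm W <= c%:E)%E.
Proof.
move=> c0 Wc; apply: ge_ereal_sup => _ [x /= x1 <-].
rewrite lee_fin (le_trans (Wc x))// ler_piMr//.
by move: x1; rewrite nrmE (lecR _ 1).
Qed.

Lemma opnorm_fin : exists2 c, 0 <= c & opnorm W = c%:E.
Proof.
have := bW; move=> /bounded_opP[_ [C C0 WC]].
have le := opnorm_le (ltW C0) WC.
have ge : (0 <= opnorm W)%E.
  apply: ereal_sup_ubound; exists 0; first by rewrite /= normr0 ler01.
  by rewrite (linear_map0 bW.1) -/(nrm 0) nrm0.
move: le ge; case: (opnorm W) => //= r _; rewrite lee_fin => r0; by exists r.
Qed.

Lemma invertible_bounded_below (A : H -> H) c : bounded_op A -> 0 < c ->
  (forall x, c * nrm x <= nrm (A x)) -> (forall y, exists x, A x = y) ->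
  invertible_op A.
Proof.
move=> [lA cA] c0 Ac /choice[B BP].
have A0 x : A x = 0 -> x = 0.
  move=> Ax; have := Ac x; rewrite Ax nrm0 pmulr_rle0// => x0.
  by apply/nrm_eq0/le_anti; rewrite x0 nrm_ge0.
have inj x y : A x = A y -> x = y.
  move=> xy; apply/eqP; rewrite -subr_eq0; apply/eqP/A0.
  by rewrite linear_mapB// xy subrr.
exists B; split; last first.
- by apply/funext => x /=; apply: inj; rewrite BP.
- exact/funext.
apply/bounded_opP; split=> [a x y|]; first by apply: inj; rewrite lA !BP.
exists c^-1 => [|x]; first by rewrite invr_gt0.
by rewrite ler_pdivlMl// -[in leRHS](BP x) Ac.
Qed.

Lemma invertible_bound (A : H -> H) : invertible_op A ->
  exists2 K, 0 < K & forall x, nrm x <= K * nrm (A x).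
Proof.
move=> [B [/bounded_opP[lB [K K0 BK]] _ BA]]; exists K => // x.
by have := BK (A x); rewrite -[B (A x)]/((B \o A) x) BA.
Qed.

(** The operator l - W is bounded below by |l| - c, so its range is closed; a vector orthogonal to
    the range would satisfy W h = conj(l) h, impossible for h nonzero since |l| > c. *)
Lemma resolvent c l : (forall x, nrm (W x) <= c * nrm x) ->
  c < complex.Re `|l| -> invertible_op (fun x : H => l *: x - W x).
Proof.
move=> Wc cl; have cl0 : 0 < complex.Re `|l| - c by rewrite subr_gt0.
have bl : bounded_op (fun x : H => l *: x - W x).
  by apply: bounded_opB => //; exact: bounded_opZ.
have lc x : (complex.Re `|l| - c) * nrm x <= nrm (l *: x - W x).
  by have := nrm_revB (l *: x) (W x); rewrite nrmZ mulrBl; have := Wc x; lra.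
apply: (invertible_bounded_below bl cl0 lc) => y.
have sr := subspace_range bl.1.
have cr := closed_image_bounded_below bl closedT (@subspace_setT _ _) cl0
  (fun x _ => lc x).
have [[x _ xy] yy] := oprojP ipH sr cr y; exists x; rewrite xy.
set h := y - _ in yy.
suff h0 : h = 0 by apply/eqP; rewrite eq_sym -subr_eq0 -/h h0.
have Wh : W h = l^*%C *: h.
  apply/esym/eqP; rewrite -subr_eq0; apply/eqP/(ip_inj ipH) => z.
  by rewrite ip0r ipBr ipZr conjcK -sW -ipZl -ipBl ipC yy ?conjc0//; exists z.
apply: nrm_eq0; have := Wc h; rewrite Wh nrmZ.
have -> : `|l^*%C| = `|l|.
  by rewrite -[LHS]/(`|Num.conj l|) norm_conjC.
rewrite -subr_le0 -mulrBl pmulr_rle0// => h0.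
by apply/le_anti; rewrite h0 nrm_ge0.
Qed.

(* If both c and -c, where c is the norm of W, were in the resolvent set, then
   |x| <= K |(W^2 - c^2) x| would yield |W x|^2 <= (c^2 - (K c)^-2) |x|^2. *)
Lemma spectral_radius_self_adjoint :
  (spectral_radius W < 1)%E <-> (opnorm W < 1)%E.
Proof.
have [c c0 Wc] := opnorm_fin.
have Wb : forall x, nrm (W x) <= c * nrm x by apply: opnorm_bound; rewrite Wc.
split; last first.
  move=> W1; apply: le_lt_trans W1; rewrite Wc.
  apply: ge_ereal_sup => _ [l ll <-].
  rewrite lee_fin leNgt; apply/negP => cl; apply: ll.
  by apply: resolvent cl; apply: opnorm_bound; rewrite Wc.
rewrite !Wc !lte_fin => rho; rewrite ltNge; apply/negP => c1.
have c0' : 0 < c by rewrite (lt_le_trans _ c1).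
have inv l : complex.Re `|l| = c -> invertible_op (fun x : H => l *: x - W x).
  move=> lc; apply: contrapT => nl; move: rho; rewrite ltNge => /negP; apply.
  rewrite (@le_trans _ _ c%:E)//.
  by apply: ereal_sup_ubound; exists l => //; rewrite lc.
have [|K1 K10 K1P] := @invertible_bound _ (inv c%:C%C _).
  by rewrite normc_real ger0_norm.
have [|K2 K20 K2P] := @invertible_bound _ (inv (- c)%:C%C _).
  by rewrite normc_real normrN ger0_norm.
(* The two resolvent bounds multiply because (-c - W)(c - W) = W^2 - c^2. *)
pose K := K1 * K2; have K0 : 0 < K by rewrite mulr_gt0.
pose d := K ^- 2 / c ^+ 2.
have d0 : 0 < d by rewrite divr_gt0// ?invr_gt0 exprn_gt0.
have Wd x : nrm (W x) ^+ 2 <= (c ^+ 2 - d) * nrm x ^+ 2.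
  have xK : nrm x <= K * nrm (W (W x) - (c ^+ 2)%:C%C *: x).
    apply: le_trans (K1P x) _; rewrite -mulrA ler_pM2l//.
    apply: le_trans (K2P _) _; rewrite ler_pM2l//.
    suff -> : (- c)%:C%C *: (c%:C%C *: x - W x) - W (c%:C%C *: x - W x) =
        W (W x) - (c ^+ 2)%:C%C *: x by [].
    rewrite (linear_mapB bW.1) (linear_mapZ bW.1) rmorphN/= scaleNr scalerBr.
    by rewrite scalerA -rmorphM/= -expr2 !opprB addrC addrA subrK.
  have Ww : nrm (W (W x)) ^+ 2 <= c ^+ 2 * nrm (W x) ^+ 2.
    by rewrite -exprMn lerXn2r ?nnegrE ?mulr_ge0 ?nrm_ge0.
  have xK2 : nrm x ^+ 2 <= K ^+ 2 * nrm (W (W x) - (c ^+ 2)%:C%C *: x) ^+ 2.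
    by rewrite -exprMn lerXn2r ?nnegrE ?mulr_ge0 ?nrm_ge0// ltW.
  rewrite (nrm_sqrB ipH) ripZr nrmZr ger0_norm ?sqr_ge0// in xK2.
  rewrite [rip ip _ x]/rip sW -/(rip ip _ _) (ripxx ipH) in xK2.
  have {}xK2 : nrm x ^+ 2 <=
      (K ^+ 2 * c ^+ 2) * (c ^+ 2 * nrm x ^+ 2 - nrm (W x) ^+ 2).
    rewrite (le_trans xK2)// -[leRHS]mulrA ler_pM2l ?exprn_gt0//.
    by move: Ww; move: (nrm (W (W x)) ^+ 2) => ?; lra.
  have Kc : 0 < K ^+ 2 * c ^+ 2 by rewrite mulr_gt0// exprn_gt0.
  move: xK2; rewrite -ler_pdivrMl// invfM -/d mulrBl; lra.
pose e := Num.sqrt (Num.max 0 (c ^+ 2 - d)).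
have me : (0 : R) <= Num.max 0 (c ^+ 2 - d) by rewrite le_max lexx.
have : (opnorm W <= e%:E)%E.
  apply: opnorm_le; first exact: sqrtr_ge0.
  move=> x; rewrite -(@ler_pXn2r _ 2) ?nnegrE ?mulr_ge0 ?nrm_ge0 ?sqrtr_ge0//.
  rewrite exprMn sqr_sqrtr// (le_trans (Wd x))// ler_wpM2r ?sqr_ge0//.
  by rewrite le_max lexx orbT.
rewrite Wc lee_fin leNgt => /negP; apply.
rewrite -(ger0_norm c0) -sqrtr_sqr ltr_sqrt ?exprn_gt0//.
by rewrite gt_max exprn_gt0//= ltrBlDr ltrDl.
Qed.

End Spectrum.

(** * The splitting *)

Section Splitting.
Context (R : realType) (H : completeNormedModType R[i]).
Variable ip : {dot H for (@Num.conj R[i])}.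
Hypothesis ipH : inner_product_norm ip.

Lemma orthogonal_projection_sym P :
  orthogonal_projection ip P -> adjoint_pair ip P P.
Proof. by move=> [bP _ Pa]; have := adjointP ipH bP; rewrite Pa. Qed.

Lemma hermitian_op_sym X : hermitian_op ip X -> adjoint_pair ip X X.
Proof. by move=> [bX Xa]; have := adjointP ipH bX; rewrite Xa. Qed.

(* The form D below is alternating, hence antisymmetric; it is also
   sesquilinear, so replacing x by i x forces D = 0. *)
Lemma positive_op_sym X : positive_op ip X -> adjoint_pair ip X X.
Proof.
move=> [[lX _] pX].
have XD := linear_mapD lX; have XZ := linear_mapZ lX.
pose D x y := ip (X x) y - ip x (X y).
have Dxx x : D x x = 0.
  apply/eqP; rewrite subr_eq0 (ipC ip x).
  have := pX x; case: (ip (X x) x) => a b; rewrite lecE/= => /andP[/eqP-> _].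
  by rewrite oppr0.
have DDD x y : D (x + y) (x + y) = D x x + D x y + D y x + D y y.
  rewrite /D !XD !ipDl !ipDr; ring.
have anti x y : D x y = - D y x.
  have := DDD x y; rewrite !Dxx add0r addr0 => /esym/eqP.
  by rewrite addr_eq0 => /eqP.
have DZl a x y : D (a *: x) y = a * D x y.
  by rewrite /D XZ !ipZl mulrBr.
have DZr a x y : D x (a *: y) = a^*%C * D x y.
  by rewrite /D XZ !ipZr mulrBr.
move=> x y; apply/eqP; rewrite -subr_eq0 -/(D x y).
rewrite anti oppr_eq0; apply/eqP.
have := anti ('i%C *: x) y; rewrite DZl DZr anti.
by case: (D y x) => a b [h1 h2]; congr Complex; lra.
Qed.

Variable T : H -> H.
Hypothesis bT : bounded_op T.

Section ClosedRangeOperator.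
Hypothesis cR : closed_range T.
Let G := range (adjoint ip T).

Let TS : adjoint_pair ip T (adjoint ip T). Proof. exact: adjointP. Qed.
Let bS : bounded_op (adjoint ip T).
Proof. exact: (bounded_adjoint ipH bT TS). Qed.
Let sG : subspace G. Proof. exact: (subspace_range bS.1). Qed.
Let cG : closed G. Proof. exact: (closed_range_adjoint ipH bT bS TS). Qed.
Let sR : subspace (range T). Proof. exact: (subspace_range bT.1). Qed.

Let TB x y : T (x - y) = T x - T y. Proof. exact: linear_mapB bT.1 _ _. Qed.

Let p := oproj ip G.
Let pB x y : p (x - y) = p x - p y.
Proof. exact: (linear_mapB (linear_oproj ipH sG cG)). Qed.

Lemma oproj_kernel x : T x = 0 -> p x = 0.
Proof.
move=> Tx; apply: (oproj_eq0 ipH sG cG) => _ [z _ <-].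
by rewrite -TS Tx ip0l.
Qed.

Lemma oproj_cokernel x : T (p x) = T x.
Proof.
apply/esym/eqP; rewrite -subr_eq0 -TB; apply/eqP.
apply: (kernel_orth_range ipH (adjoint_pairC TS)).
exact: (oprojP ipH sG cG x).2.
Qed.

(** * Operators whose adjoint is a projection times a self-adjoint operator *)

Section Factor.
Variables P X : H -> H.
Hypotheses (sP : adjoint_pair ip P P) (PP : P \o P = P).
Hypotheses (sX : adjoint_pair ip X X) (TPX : P \o X = adjoint ip T).

(** The range of T^* = P X lies in that of P, so P p = p and T = T p = X P p = X p. *)
Lemma factor_oproj x : T x = X (p x).
Proof.
rewrite -oproj_cokernel.
have [u _ pu] := (oprojP ipH sG cG x).1; rewrite -/p in pu.
have {}pu : P (p x) = p x by rewrite -pu -TPX /= -[P (P _)]/((P \o P) _) PP.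
apply: (ip_inj ipH) => z; rewrite ipC TS -TPX /= -sP pu -sX -ipC//.
Qed.

(** A Lax-Milgram argument: p T is coercive on [G], hence a bijection of [G], and solving p T g = p
    x gives the component T g of x in R(T). *)
Lemma positive_direct_sum : positive_op ip X ->
  direct_sum (range T) (kernel T).
Proof.
move=> [bX pX]; have lX := bX.1.
have rX x : 0 <= rip ip (X x) x by have := pX x; rewrite lecE => /andP[].
have Gp x : G (p x) by exact: (oprojP ipH sG cG x).1.
have pG g : G g -> p g = g by exact: (oproj_id ipH sG cG).
have [c c0 cP] := adjoint_bounded_below ipH bS bT (adjoint_pairC TS) cG.
have /bounded_opP[_ [C C0 XC]] := bX.
have CX x : nrm (X x) ^+ 2 <= C * rip ip (X x) x.
  (* Positivity at this vector, with |X| <= C, gives |X x|^2 <= C <X x, x>. *)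
  have := rX (x - (C^-1)%:C%C *: X x).
  rewrite (linear_mapB lX) (linear_mapZ lX) ripBl !ripBr !ripZl !ripZr.
  rewrite (ripxx ipH).
  rewrite [rip ip (X (X x)) x]/rip sX -/(rip ip _ _) (ripxx ipH).
  have h : rip ip (X (X x)) (X x) <= C * nrm (X x) ^+ 2.
    rewrite (le_trans (rip_le ipH _ _))// expr2 mulrA.
    by rewrite ler_wpM2r ?nrm_ge0.
  have {}h : C^-1 * (C^-1 * rip ip (X (X x)) (X x)) <= C^-1 * nrm (X x) ^+ 2.
    by rewrite ler_wpM2l ?invr_ge0 ?(ltW C0)// ler_pdivrMl.
  by rewrite -ler_pdivrMl//; lra.
pose a := c ^+ 2 / C; have a0 : 0 < a by rewrite divr_gt0// exprn_gt0.
have coercive g : G g -> a * nrm g ^+ 2 <= rip ip (p (T g)) g.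
  move=> Gg; rewrite [leRHS]/rip /p (oproj_sym ipH sG cG) -/p (pG _ Gg).
  rewrite -/(rip ip _ _).
  rewrite factor_oproj (pG _ Gg) /a mulrAC ler_pdivrMr// [leRHS]mulrC.
  rewrite (le_trans _ (CX g))// -exprMn.
  rewrite lerXn2r ?nnegrE ?mulr_ge0 ?nrm_ge0 ?(ltW c0)//.
  by have := cP _ Gg; rewrite factor_oproj (pG _ Gg).
have eq0 g : G g -> rip ip (p (T g)) g = 0 -> g = 0.
  move=> Gg g0; have := coercive _ Gg; rewrite g0 pmulr_rle0// => h.
  by apply/nrm_eq0/eqP; rewrite -sqrf_eq0 eq_le h sqr_ge0.
have bpT : bounded_op (p \o T).
  by apply: bounded_op_comp => //; exact: bounded_oproj.
have pTc g : G g -> a * nrm g <= nrm ((p \o T) g).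
  move=> Gg; have [->|g0] := eqVneq (nrm g) 0; first by rewrite mulr0 nrm_ge0.
  rewrite -(@ler_pM2r _ (nrm g)) ?lt_neqAle ?nrm_ge0 1?eq_sym ?g0//.
  by rewrite -mulrA -expr2 (le_trans (coercive _ Gg))// rip_le.
have sM := subspace_image sG bpT.1.
have cM := closed_image_bounded_below bpT cG sG a0 pTc.
split=> [x|].
  have [[g Gg pg] xM] := oprojP ipH sM cM (p x).
  set h := p x - _ in xM.
  have Gh : G h by apply: subspaceB => //; rewrite -pg; exact: Gp.
  (* The residual [h] is orthogonal to p T h, so coercivity annihilates it. *)
  have h0 : h = 0.
    apply: eq0 => //; rewrite ripC /rip xM//; by exists h.
  exists (T g); first by exists g.
  rewrite /kernel/= -oproj_cokernel pB -[p (T g)]/((p \o T) g) pg -/h h0.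
  exact: linear_map0 bT.1.
apply/seteqP; split=> [_ [[u _ <-] TTu]|_ ->]; last first.
  by split; [exact: sR.1|exact: linear_map0 bT.1].
rewrite /= -oproj_cokernel (_ : p u = 0) ?(linear_map0 bT.1)//.
apply: eq0 => //; rewrite oproj_cokernel (oproj_kernel TTu).
by rewrite /rip ip0l.
Qed.

End Factor.

(* On G = range T^*, |g - p P g|^2 <= |g|^2 - |P g|^2, and |P g| = |T g| is
   bounded below there. *)
Lemma opnorm_projection_product P P' :
  adjoint_pair ip P P -> P \o P = P ->
  adjoint_pair ip P' P' -> P' \o P' = P' -> P' \o P = adjoint ip T ->
  (opnorm (orth_proj_range ip (adjoint ip T) \o (id \- T)%R) < 1)%E.
Proof.
move=> sP PP sP' PP' TP; have TX := factor_oproj sP' PP' sP TP.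
have [c c0 cP] := adjoint_bounded_below ipH bS bT (adjoint_pairC TS) cG.
have -> : orth_proj_range ip (adjoint ip T) = p by [].
(* If [G] is zero, [c] may exceed 1; hence the truncation at 0. *)
pose m := Num.max 0 (1 - c ^+ 2); have m0 : 0 <= m by rewrite le_max lexx.
apply: (@le_lt_trans _ _ (Num.sqrt m)%:E); last first.
  rewrite lte_fin -[ltRHS]sqrtr1 ltr_sqrt ?ltr01// gt_max ltr01/=.
  by rewrite ltrBlDr ltrDl exprn_gt0.
apply: opnorm_le; first exact: sqrtr_ge0.
move=> x /=; rewrite -(@ler_pXn2r _ 2) ?nnegrE ?mulr_ge0 ?nrm_ge0 ?sqrtr_ge0//.
rewrite exprMn sqr_sqrtr// pB TX.
have Gx : G (p x) by exact: (oprojP ipH sG cG x).1.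
have px : nrm (p x) <= nrm x by exact: nrm_oproj.
have pPx : nrm (p (P (p x))) <= nrm (P (p x)) by exact: nrm_oproj.
have pp : p (p x) = p x by exact: (oproj_id ipH sG cG).
have Px : c * nrm (p x) <= nrm (P (p x)).
  by have := cP _ Gx; rewrite TX pp.
have r : rip ip (p x) (p (P (p x))) = nrm (P (p x)) ^+ 2.
  rewrite -(ripxx ipH) /rip -(oproj_sym ipH sG cG) -/p pp.
  by rewrite sP -[P (P _)]/((P \o P) _) PP.
rewrite (nrm_sqrB ipH) r.
have h1 : nrm (p (P (p x))) ^+ 2 <= nrm (P (p x)) ^+ 2.
  by rewrite lerXn2r ?nnegrE ?nrm_ge0.
have h2 : c ^+ 2 * nrm (p x) ^+ 2 <= nrm (P (p x)) ^+ 2.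
  by rewrite -exprMn lerXn2r ?nnegrE ?mulr_ge0 ?nrm_ge0 ?(ltW c0).
have h3 : (1 - c ^+ 2) * nrm (p x) ^+ 2 <= m * nrm x ^+ 2.
  rewrite (@le_trans _ _ (m * nrm (p x) ^+ 2))//.
    by rewrite ler_wpM2r ?sqr_ge0// le_max lexx orbT.
  by rewrite ler_wpM2l// lerXn2r ?nnegrE ?nrm_ge0.
lra.
Qed.

(** * The oblique projection, its Moore-Penrose inverse and the iteration operator *)

Section Oblique.
Hypothesis dT : direct_sum (range T) (kernel T).
Let Q := oblique_proj T.

Lemma oblique_projP x : range T (Q x) /\ T (x - Q x) = 0.
Proof.
have [/(_ x)[y Ry Ny] _] := dT.
by apply: (@xgetPex _ 0 [set y | range T y /\ kernel T (x - y)]); exists y.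
Qed.

Lemma oblique_proj_unique x y : range T y -> T (x - y) = 0 -> Q x = y.
Proof.
move=> Ry Ny; have [RQ NQ] := oblique_projP x.
have [_ RN] := dT.
have : (range T `&` kernel T) (Q x - y).
  split; first exact: subspaceB.
  rewrite /kernel/= (_ : Q x - y = (x - y) - (x - Q x)).
    by rewrite (TB (x - y)) Ny NQ subrr.
  by rewrite opprB [RHS]addrC addrA subrK.
by rewrite RN => /= /eqP; rewrite subr_eq0 => /eqP.
Qed.

Lemma oblique_proj_id y : range T y -> Q y = y.
Proof.
by move=> Ry; apply: oblique_proj_unique; rewrite // subrr (linear_map0 bT.1).
Qed.

Lemma oblique_proj_kernel x : T x = 0 -> Q x = 0.
Proof.
by move=> Tx; apply: oblique_proj_unique; rewrite ?subr0//; exact: sR.1.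
Qed.

Lemma oblique_projB x y : Q (x - y) = Q x - Q y.
Proof.
have [Rx Nx] := oblique_projP x; have [Ry Ny] := oblique_projP y.
apply: oblique_proj_unique; first exact: subspaceB.
by rewrite opprD addrACA -opprD TB Nx Ny subrr.
Qed.

(** With r the orthogonal projection onto R(T), Q (p r) = r and (p r) Q = p; both products are
    orthogonal projections, which settles the Penrose equations. *)
Lemma moore_penrose_oblique_proj_exists :
  is_moore_penrose ip Q (p \o oproj ip (range T)).
Proof.
pose r := oproj ip (range T).
have Rr x : range T (r x) by exact: (oprojP ipH sR cR x).1.
have Qp x : Q (p x) = Q x.
  apply: esym; apply/eqP; rewrite -subr_eq0 -oblique_projB; apply/eqP.
  by apply: oblique_proj_kernel; rewrite TB oproj_cokernel subrr.
have QX : Q \o (p \o r) = r.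
  by apply/funext => x /=; rewrite Qp oblique_proj_id.
have XQ : (p \o r) \o Q = p.
  apply/funext => x /=; have [Rx Nx] := oblique_projP x.
  rewrite /r (oproj_id ipH sR cR)//; apply/esym/eqP; rewrite -subr_eq0.
  by rewrite -pB oproj_kernel.
split.
  by apply: bounded_op_comp; exact: bounded_oproj.
split; rewrite -/r ?QX ?XQ.
- apply/funext => x /=; rewrite /r (oproj_id ipH sR cR)//.
  exact: (oblique_projP x).1.
- apply/funext => x /=; rewrite /p (oproj_id ipH sG cG)//.
  exact: (oprojP ipH sG cG _).1.
- by apply: (adjoint_unique ipH) => x y; exact: oproj_sym.
- by apply: (adjoint_unique ipH) => x y; exact: oproj_sym.
Qed.

(* F = X Q is idempotent with the kernel of Q. Boundedness of Q is not at hand,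
   but where the adjoint takes a nonzero value it is not the default value of
   xget, which gives self-adjointness of F on its range. *)
Lemma moore_penrose_oblique_projE X y :
  is_moore_penrose ip Q X -> X (Q y) = p y.
Proof.
move=> [bX [QXQ XQX _ Fa]].
have FF x : X (Q (X (Q x))) = X (Q x) by have := congr1 (@^~ (Q x)) XQX.
have Fsym x u : ip (X (Q x)) (X (Q u)) = ip x (X (Q u)).
  have [->|u0] := eqVneq (X (Q u)) 0; first by rewrite !ip0r.
  have : adjoint ip (X \o Q) (X (Q u)) = X (Q u) by rewrite Fa /= FF.
  rewrite /adjoint; case: xgetP => [z _ zP zu|_ h].
    by rewrite -[in RHS]zu; exact: zP.
  by rewrite -h eqxx in u0.
have QF x : Q (x - X (Q x)) = 0.
  by rewrite oblique_projB -[Q (X (Q x))]/((Q \o X \o Q) x) QXQ subrr.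
have TQ x : Q x = 0 -> T x = 0.
  by move=> Qx; have [_] := oblique_projP x; rewrite Qx subr0.
(* By [Fsym], F y is orthogonal to N(T), as F vanishes there; the closed range theorem then puts it
   in [G]. *)
have GF : G (X (Q y)).
  apply: (orth_kernel_range ipH bT bS TS) => // x Tx.
  rewrite ipC -Fsym oblique_proj_kernel// (linear_map0 bX.1) ip0l conjc0//.
apply/esym; apply: (oproj_unique ipH sG cG) => // _ [z _ <-].
by rewrite -TS (TQ _ (QF y)) ip0l.
Qed.

(** Q - T maps into R(T), where the Moore-Penrose inverse acts as p; moreover p Q = p, since x - Q x
    lies in N(T), which p annihilates. *)
Lemma splitting_iteration :
  moore_penrose ip Q \o (Q \- T) = p \o (id \- T).
Proof.
apply/funext => x /=.
have mpQ : is_moore_penrose ip Q (moore_penrose ip Q).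
  apply: (@xgetPex _ _ (is_moore_penrose ip Q)).
  exists (p \o oproj ip (range T)).
  exact: moore_penrose_oblique_proj_exists.
have [Rx Nx] := oblique_projP x.
have Ry : range T (Q x - T x) by apply: subspaceB => //; exists x.
rewrite -[in LHS](oblique_proj_id Ry) (moore_penrose_oblique_projE _ mpQ).
apply/eqP; rewrite -subr_eq0 -pB.
rewrite opprB addrA subrK -opprB oproj_kernel//.
by rewrite -[RHS]oppr0 -Nx -(linear_mapN bT.1).
Qed.

Lemma QT_splitting_convergesP P X : adjoint_pair ip P P -> P \o P = P ->
  adjoint_pair ip X X -> P \o X = adjoint ip T ->
  (QT_splitting_converges ip T <->
   (opnorm (orth_proj_range ip (adjoint ip T) \o (id \- T)%R) < 1)%E).
Proof.
move=> sP PP sX TPX; have TX := factor_oproj sP PP sX TPX.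
rewrite /QT_splitting_converges /splitting_converges splitting_iteration.
have -> : orth_proj_range ip (adjoint ip T) = p by [].
apply: (spectral_radius_self_adjoint ipH).
  apply: bounded_op_comp; first exact: bounded_oproj.
  by apply: bounded_opB => //; exact: bounded_op_id.
move=> x y /=; rewrite !pB ipBl ipBr.
congr (_ - _); first exact: oproj_sym.
by rewrite !TX oproj_sym// sX -[in RHS]oproj_sym.
Qed.

End Oblique.
End ClosedRangeOperator.

End Splitting.

Theorem corollary5p3 (R : realType) (H : completeNormedModType R[i])
    (ip : {dot H for (@Num.conj R[i])}) (ipH : inner_product_norm ip) :
  [/\ forall T : H -> H, bounded_op T -> split_op T ->
        op_products (orthogonal_projection ip) (hermitian_op ip)
          (adjoint ip T) ->
        (QT_splitting_converges ip T <->
         (opnorm (orth_proj_range ip (adjoint ip T) \o (id \- T)%R) < 1)%E),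
      forall T : H -> H, bounded_op T -> closed_range T ->
        op_products (orthogonal_projection ip) (positive_op ip)
          (adjoint ip T) ->
        (QT_splitting_converges ip T <->
         (opnorm (orth_proj_range ip (adjoint ip T) \o (id \- T)%R) < 1)%E)
    & forall T : H -> H, bounded_op T -> closed_range T ->
        op_products (orthogonal_projection ip) (orthogonal_projection ip) T ->
        QT_splitting_converges ip T].
Proof.
split=> [T bT [cR dT] [P oP [X hX TPX]]|T bT cR [P oP [X pX TPX]]
        |T bT cR [P oP [P' oP' TPP]]].
- have [_ PP _] := oP.
  have sP := orthogonal_projection_sym ipH oP.
  have sX := hermitian_op_sym ipH hX.
  exact: (QT_splitting_convergesP ipH bT cR dT sP PP sX TPX).
- have [_ PP _] := oP; have sP := orthogonal_projection_sym ipH oP.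
  have sX := positive_op_sym pX.
  have dT := positive_direct_sum ipH bT cR sP PP sX TPX pX.
  exact: (QT_splitting_convergesP ipH bT cR dT sP PP sX TPX).
- have [bP PP _] := oP; have sP := orthogonal_projection_sym ipH oP.
  have [_ PP' _] := oP'; have sP' := orthogonal_projection_sym ipH oP'.
  (* Taking adjoints exchanges the factors: [P'] becomes the projection and [P] the positive
     factor. *)
  have TP : P' \o P = adjoint ip T.
    by apply/esym/(adjoint_unique ipH) => x y; rewrite -TPP /= sP sP'.
  have pP : positive_op ip P.
    split=> // x; rewrite -[P x]/(P x) -PP /= sP -ipH exprn_ge0//.
  have dT := positive_direct_sum ipH bT cR sP' PP' sP TP pP.
  apply/(QT_splitting_convergesP ipH bT cR dT sP' PP' sP TP).
  exact: (opnorm_projection_product ipH bT cR sP PP sP' PP' TP).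
Qed.
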